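(* The group $\mathrm{WPic}_{\mathbb{Z}\langle G\rangle}$ is finite; that is, for fixed $G$ and $u$ there are only finitely many $G$-isomorphism classes of invertible $G$-lattices.
   Context: Let $G$ be a finite abelian group with a fixed element $u$ of order $2$ and $n=\#G/2$. A lattice is a finitely generated abelian group with a bilinear, symmetric, positive definite $\mathbb{Z}$-valued form. A $G$-lattice is a lattice with a homomorphism from $G$ to its form-preserving automorphisms in which $u$ acts as $-1$; $G$-isomorphisms are form-preserving group isomorphisms commuting with the actions. A $G$-lattice $L$ is invertible if it has rank $n$, Gram determinant $1$, and for every $m\in\mathbb{Z}_{>0}$ some $e_m\in L$ has $\{\sigma e_m+mL:\sigma\in G\}$ generating $L/mL$ as an abelian group. $\mathrm{WPic}_{\mathbb{Z}\langle G\rangle}$ is the set of $G$-isomorphism classes of invertible $G$-lattices, with group law given by tensor product over $\mathbb{Z}\langle G\rangle=\mathbb{Z}[G]/(u+1)$. *)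

(* Defs.v *)
From HB Require Import structures.
From mathcomp Require Import all_boot all_order all_fingroup all_algebra.

Set Implicit Arguments.
Unset Strict Implicit.
Unset Printing Implicit Defensive.

Import Order.TTheory GRing.Theory Num.Theory.
Local Open Scope ring_scope.

Definition int_span (L : zmodType) (I : finType) (b : I -> L) (x : L) : Prop :=
  exists c : I -> int, x = \sum_(i : I) b i *~ c i.

Definition finitely_generated (L : zmodType) : Prop :=
  exists (k : nat) (b : 'I_k -> L), forall x : L, int_span b x.

Record lattice : Type := Lattice {
  lat_sort :> zmodType;
  form : lat_sort -> lat_sort -> int;
  lat_fg : finitely_generated lat_sort;
  formDl : forall x y z, form (x + y) z = form x z + form y z;
  formDr : forall x y z, form x (y + z) = form x y + form x z;
  formC : forall x y, form x y = form y x;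
  form_posdef : forall x, x != 0 -> 0 < form x x
}.

(* The axioms make each [act s] an automorphism, with inverse [act s^-1]. *)
Record glattice (G : finGroupType) (u : G) : Type := GLattice {
  glat :> lattice;
  act : G -> glat -> glat;
  act1 : forall x, act 1%g x = x;
  actM : forall s t x, act (s * t)%g x = act s (act t x);
  actD : forall s x y, act s (x + y) = act s x + act s y;
  act_form : forall s x y, form (act s x) (act s y) = form x y;
  act_u : forall x, act u x = - x
}.

Definition giso (G : finGroupType) (u : G) (L M : glattice u) : Prop :=
  exists f : {additive L -> M},
    [/\ bijective f,
        forall x y, form (f x) (f y) = form x y
      & forall s x, f (act s x) = act s (f x)].

Definition zbasis (L : zmodType) (k : nat) (b : 'I_k -> L) : Prop :=
  (forall x : L, int_span b x) /\
  (forall c : 'I_k -> int, \sum_(i < k) b i *~ c i = 0 -> forall i, c i = 0).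

(* A lattice is torsion-free (its form is positive definite) and finitely
   generated, hence free: its rank is the size of its bases. *)
Definition has_rank (L : lattice) (k : nat) : Prop :=
  exists b : 'I_k -> L, zbasis b.

Definition gram (L : lattice) (k : nat) (b : 'I_k -> L) : 'M[int]_k :=
  \matrix_(i, j) form (b i) (b j).

Definition has_gram_det (L : lattice) (d : int) : Prop :=
  exists (k : nat) (b : 'I_k -> L), zbasis b /\ \det (gram b) = d.

(* The cosets s e + mL generate L/mL iff every x in L is congruent mod mL to
   an integer combination of the s e. *)
Definition generates_mod (G : finGroupType) (u : G) (L : glattice u)
    (m : nat) (e : L) : Prop :=
  forall x : L, exists y : L, int_span (fun s : G => act s e) (x - y *+ m).

Definition invertible (G : finGroupType) (u : G) (L : glattice u) : Prop :=
  [/\ has_rank L (#|G| %/ 2),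
      has_gram_det L 1
    & forall m : nat, (0 < m)%N -> exists e : L, generates_mod m e].

(* MathComp-Analysis's [set] and [finite_set] cannot be used here: their
   universe lies strictly below that of [zmodType], hence of [glattice]. *)
Definition finite_pred (T : Type) (P : T -> Prop) : Prop :=
  exists (k : nat) (F : 'I_k -> T), forall x : T, P x <-> exists i, x = F i.

(* A class is a predicate on G-lattices; WPic is the collection of those of the
   form [giso L] with L invertible. *)
Definition WPic (G : finGroupType) (u : G) (C : glattice u -> Prop) : Prop :=
  exists2 L : glattice u, invertible L & C = giso L.

(* Main.v *)
From HB Require Import structures.
From mathcomp Require Import all_boot all_order all_fingroup all_algebra.
From mathcomp Require Import zify ring lra boolp.
Require Import Defs.

(** Hermite reduction bounds the Gram matrix of a suitable basis of a positive
    definite integral lattice in terms of its rank and determinant.  For such a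
    basis b of a G-lattice, Cauchy-Schwarz then bounds all the integers
    <s b_i, b_j>, s in G, because s preserves the form; and these integers
    determine the G-lattice up to G-isomorphism, because the form is
    nondegenerate. *)

Set Implicit Arguments.
Unset Strict Implicit.
Unset Printing Implicit Defensive.

Import Order.TTheory GRing.Theory Num.Theory.
Local Open Scope ring_scope.

(** * Finite predicates *)

Lemma finite_pred_rel (K : finType) (T : Type) (P : T -> Prop)
    (R : T -> K -> Prop) :
    (forall x, P x -> exists k, R x k) ->
    (forall x y k, P x -> P y -> R x k -> R y k -> x = y) ->
  finite_pred P.
Proof.
move=> totalR injR; pose hit := [pred k | `[< exists x, P x /\ R x k >]].
have /fin_all_exists[F FP] (k : {k | hit k}) : exists x, P x /\ R x (val k).
  exact/asboolP/(valP k).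
exists #|{: {k | hit k}}|, (F \o enum_val) => x.
split=> [Px|[i ->]]; last by case: (FP (enum_val i)).
have [k Rxk] := totalR x Px.
have hit_k : hit k by apply/asboolP; exists x.
exists (enum_rank (Sub k hit_k : {k | hit k})); rewrite /= enum_rankK.
by have [PF RF] := FP (Sub k hit_k); apply: injR Rxk RF.
Qed.

Lemma finite_pred_sub (T : Type) (P Q : T -> Prop) :
  (forall x, P x -> Q x) -> finite_pred Q -> finite_pred P.
Proof.
move=> subPQ [k [F FP]].
apply: (@finite_pred_rel 'I_k _ _ (fun x i => x = F i)) => [x /subPQ/FP //|].
by move=> x y i _ _ -> ->.
Qed.

Lemma finite_pred_bounded_code (I : finType) (B : nat) (T : Type)
    (P : T -> Prop) (R : T -> {ffun I -> int} -> Prop) :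
    (forall x, P x -> exists2 c, R x c & forall i, `|c i| <= B%:Z) ->
    (forall x y c, P x -> P y -> R x c -> R y c -> x = y) ->
  finite_pred P.
Proof.
move=> boundedR injR; pose decode (k : {ffun I -> 'I_(B + B).+1}) :=
  [ffun i => (k i)%:Z - B%:Z].
pose R_decode x k := R x (decode k).
apply: (@finite_pred_rel _ _ _ R_decode) => [x Px|x y k]; last exact: injR.
have [c Rxc le_c_B] := boundedR x Px; rewrite /R_decode.
exists [ffun i => inord (absz (c i + B%:Z))]; congr (R x _): Rxc.
by apply/ffunP=> i; rewrite !ffunE inordK; have := le_c_B i; lia.
Qed.

(** * Congruence of matrices *)

Definition congmx (R : pzRingType) (m n : nat) (U : 'M[R]_(m, n))
    (A : 'M[R]_n) : 'M[R]_m :=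
  U *m A *m U^T.

Section CongruenceTheory.

Variable R : comPzRingType.

Lemma congmxM (m n p : nat) (U : 'M[R]_(m, n)) (V : 'M[R]_(n, p))
    (A : 'M[R]_p) :
  congmx (U *m V) A = congmx U (congmx V A).
Proof. by rewrite /congmx trmx_mul !mulmxA. Qed.

Lemma tr_congmx (m n : nat) (U : 'M[R]_(m, n)) (A : 'M[R]_n) :
  (congmx U A)^T = congmx U A^T.
Proof. by rewrite /congmx !trmx_mul trmxK mulmxA. Qed.

Lemma congmxZ (m n : nat) (a : R) (U : 'M[R]_(m, n)) (A : 'M[R]_n) :
  congmx U (a *: A) = a *: congmx U A.
Proof. by rewrite /congmx -scalemxAr -scalemxAl. Qed.

Lemma congmxE (m n : nat) (U : 'M[R]_(m, n)) (A : 'M[R]_n) (i j : 'I_m) :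
  congmx U A i j = (row i U *m A *m (row j U)^T) 0 0.
Proof. by rewrite tr_row -row_mul colE mulmxA -row_mul -colE !mxE. Qed.

Lemma congmx_row (m n : nat) (U : 'M[R]_(m, n)) (A : 'M[R]_n) (i : 'I_m) :
  congmx (row i U) A 0 0 = congmx U A i i.
Proof. by rewrite [RHS]congmxE. Qed.

Lemma congmx1 (n : nat) (A : 'M[R]_n) : congmx 1%:M A = A.
Proof. by rewrite /congmx trmx1 mulmx1 mul1mx. Qed.

End CongruenceTheory.

Lemma row_unitmx_neq0 (R : comUnitRingType) (n : nat) (U : 'M[R]_n)
    (i : 'I_n) :
  U \in unitmx -> row i U != 0.
Proof.
move=> uU; apply/eqP => /(congr1 (mulmx^~ (invmx U))).
rewrite -row_mul mulmxV // mul0mx => /rowP/(_ i)/eqP.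
by rewrite !mxE eqxx oner_eq0.
Qed.

Lemma det_congmx_unit (n : nat) (U A : 'M[int]_n) :
  U \in unitmx -> \det (congmx U A) = \det A.
Proof. by rewrite !det_mulmx det_tr unitmxE => /orP[]/eqP ->; ring. Qed.

(** * Positive definite matrices *)

Definition posdefmx (R : numDomainType) (n : nat) (A : 'M[R]_n) : Prop :=
  A^T = A /\ forall x : 'rV[R]_n, x != 0 -> 0 < congmx x A 0 0.

Lemma posdefmx_congmx (R : numDomainType) (n : nat) (U A : 'M[R]_n) :
  U \in unitmx -> posdefmx A -> posdefmx (congmx U A).
Proof.
move=> uU [symA posA]; split=> [|x x_neq0]; first by rewrite tr_congmx symA.
rewrite -congmxM; apply: posA; apply: contraNneq x_neq0 => xU0.
by rewrite -(mulmxK uU x) xU0 mul0mx.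
Qed.

Lemma posdefmx_diag_gt0 (R : numDomainType) (n : nat) (A : 'M[R]_n)
    (i : 'I_n) :
  posdefmx A -> 0 < A i i.
Proof.
move=> [_ posA]; rewrite -[A]congmx1 -congmx_row.
exact/posA/row_unitmx_neq0/unitmx1.
Qed.

Lemma posdefmx_diag_le_prod (n : nat) (A : 'M[int]_n) (i : 'I_n) :
  posdefmx A -> A i i <= \prod_j A j j.
Proof.
move=> pA; rewrite (bigD1 i) //=; apply: ler_peMr.
  exact/ltW/posdefmx_diag_gt0.
by rewrite -gtz0_ge1; apply: prodr_gt0 => j _; apply: posdefmx_diag_gt0.
Qed.

(** * Bordered matrices and Schur complements *)

Section BorderedMatrices.

Variables (R : comNzRingType) (n : nat).
Implicit Types (a : R) (r : 'rV[R]_n) (D : 'M[R]_n).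

Definition bordermx a r D : 'M[R]_(1 + n) := block_mx a%:M r r^T D.

(** The Schur complement scaled by [a], so that no division occurs.  For a Gram
    matrix it is [a] times the Gram matrix of the projections of the other basis
    vectors orthogonally to the first one. *)
Definition schurmx a r D : 'M[R]_n := a *: D - r^T *m r.

Definition elimmx a r : 'M[R]_(n, 1 + n) := row_mx (- r^T) a%:M.

Lemma bordermx_diag0 a r D (i : 'I_1) :
  bordermx a r D (lshift n i) (lshift n i) = a.
Proof. by rewrite block_mxEul mxE eqxx. Qed.

Lemma bordermx_diagS a r D (i : 'I_n) :
  bordermx a r D (rshift 1 i) (rshift 1 i) = D i i.
Proof. exact: block_mxEdr. Qed.

Lemma symmx_bordermx (A : 'M[R]_(1 + n)) :
  A^T = A -> exists a r D, A = bordermx a r D.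
Proof.
move=> symA; exists (ulsubmx A 0 0), (ursubmx A), (drsubmx A).
by rewrite /bordermx -mx11_scalar trmx_ursub symA submxK.
Qed.

Lemma tr_bordermx_sym a r D : (bordermx a r D)^T = bordermx a r D -> D^T = D.
Proof. by rewrite tr_block_mx trmxK => /eq_block_mx[]. Qed.

Lemma elimmx_bordermx a r D :
  elimmx a r *m bordermx a r D = row_mx 0 (schurmx a r D).
Proof.
rewrite mul_row_block mul_mx_scalar !mul_scalar_mx scalerN addNr.
by rewrite mulNmx addrC.
Qed.

Lemma congmx_elimmx a r D :
  congmx (elimmx a r) (bordermx a r D) = a *: schurmx a r D.
Proof.
rewrite /congmx elimmx_bordermx tr_row_mx mul_row_col mul0mx add0r.
by rewrite tr_scalar_mx mul_mx_scalar.
Qed.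

Lemma det_bordermx a r D :
  a ^+ n * \det (bordermx a r D) = a * \det (schurmx a r D).
Proof.
have : col_mx (row_mx 1%:M 0) (elimmx a r) *m bordermx a r D
    = block_mx a%:M r 0 (schurmx a r D).
  rewrite mul_col_mx elimmx_bordermx mul_row_block !mul1mx !mul0mx !addr0.
  exact: erefl.
move=> /(congr1 determinant); rewrite det_mulmx.
rewrite -[col_mx _ _]/(block_mx _ _ _ _).
by rewrite det_lblock det_ublock !det_scalar expr1n mul1r expr1.
Qed.

(** The change of basis [block_mx 1 0 t^T U] translates by multiples of the
    first basis vector and so acts on the orthogonal projection through U. *)
Lemma congmx_bordermx a r D (t : 'rV[R]_n) (U : 'M[R]_n) : D^T = D ->
  exists2 E, congmx (block_mx 1%:M 0 t^T U) (bordermx a r D)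
      = bordermx a (a *: t + r *m U^T) E
    & schurmx a (a *: t + r *m U^T) E = congmx U (schurmx a r D).
Proof.
move=> symD; set W := block_mx _ _ _ _; set r' := _ + _.
pose E := r'^T *m t + (t^T *m r + U *m D) *m U^T.
have r'T : r'^T = a *: t^T + U *m r^T.
  by rewrite linearD linearZ /= trmx_mul trmxK.
have defW : congmx W (bordermx a r D) = bordermx a r' E.
  rewrite /congmx tr_block_mx !mulmx_block trmx1 trmx0 trmxK.
  rewrite !(mul1mx, mul0mx, mulmx0, mulmx1, addr0).
  by rewrite mul_scalar_mx mul_mx_scalar -r'T.
exists E => //; have elimW : elimmx a r' *m W = U *m elimmx a r.
  rewrite mul_row_block mul_mx_row mulmx0 add0r mulmx1 mulmxN.
  by rewrite !mul_scalar_mx mul_mx_scalar r'T opprD addrAC addNr add0r.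
have := elimmx_bordermx a r' E; rewrite -defW /congmx !mulmxA elimW.
rewrite -(mulmxA U) elimmx_bordermx mul_mx_row mulmx0 tr_block_mx.
by rewrite mul_row_block !mul0mx add0r trmx0 mulmx0 add0r => /eq_row_mx[].
Qed.

End BorderedMatrices.

Lemma posdefmx_bordermx_gt0 (R : numDomainType) (n : nat) (a : R)
    (r : 'rV[R]_n) (D : 'M[R]_n) :
  posdefmx (bordermx a r D) -> 0 < a.
Proof. by move/(posdefmx_diag_gt0 (lshift n 0)); rewrite bordermx_diag0. Qed.

Lemma posdefmx_schurmx (R : numDomainType) (n : nat) (a : R) (r : 'rV[R]_n)
    (D : 'M[R]_n) :
  posdefmx (bordermx a r D) -> posdefmx (schurmx a r D).
Proof.
move=> pB; have [symB posB] := pB; have symD := tr_bordermx_sym symB.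
have a_gt0 := posdefmx_bordermx_gt0 pB.
split=> [|x x_neq0].
  by rewrite linearB linearZ /= trmx_mul trmxK symD.
suff : 0 < congmx (x *m elimmx a r) (bordermx a r D) 0 0.
  by rewrite congmxM congmx_elimmx congmxZ mxE pmulr_rgt0.
apply: posB; rewrite mul_mx_row mul_mx_scalar; apply: contraNneq x_neq0.
rewrite -row_mx0 => /eq_row_mx[_ /eqP].
by rewrite scalemx_eq0 gt_eqF.
Qed.

(** * Hermite reduction *)

(** Hermite's bound [\prod_i A i i <= (4 / 3) ^+ 'C(n, 2) * \det A], cleared of
    denominators. *)
Definition hermite_bounded (R : numDomainType) (n : nat) (A : 'M[R]_n) : Prop :=
  3 ^+ 'C(n, 2) * \prod_i A i i <= 4 ^+ 'C(n, 2) * \det A.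

Lemma schurmx_diag_ge (R : realDomainType) (n : nat) (a : R) (r : 'rV[R]_n)
    (D : 'M[R]_n) (i : 'I_n) :
    0 <= a -> a <= D i i -> 4 * r 0 i ^+ 2 <= a ^+ 2 ->
  3 * (a * D i i) <= 4 * schurmx a r D i i.
Proof.
move=> a_ge0 le_aD le_ra; rewrite !mxE big_ord1 !mxE.
have : a * a <= a * D i i by rewrite ler_wpM2l.
rewrite !expr2 in le_ra; lra.
Qed.

Lemma hermite_bounded_bordermx (R : realDomainType) (n : nat) (a : R)
    (r : 'rV[R]_n) (D : 'M[R]_n) :
    0 < a -> (forall i, 0 <= D i i) ->
    (forall i, 3 * (a * D i i) <= 4 * schurmx a r D i i) ->
    hermite_bounded (schurmx a r D) ->
  hermite_bounded (bordermx a r D).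
Proof.
move=> a_gt0 D_ge0 leDS bndS.
have le_prod : 3 ^+ n * (a ^+ n * \prod_i D i i)
    <= 4 ^+ n * \prod_i schurmx a r D i i.
  have : \prod_i (3 * (a * D i i)) <= \prod_i (4 * schurmx a r D i i).
    by apply: ler_prod => i _; rewrite leDS andbT !mulr_ge0 // ltW.
  by rewrite !big_split /= !prodr_const card_ord.
have le_schur : 3 ^+ 'C(n.+1, 2) * (a ^+ n * \prod_i D i i)
    <= 4 ^+ 'C(n.+1, 2) * \det (schurmx a r D).
  rewrite binS bin1 !exprD -!mulrA [leRHS]mulrCA.
  apply: le_trans (ler_wpM2l (exprn_ge0 _ _) le_prod) _ => //.
  by rewrite [leLHS]mulrCA ler_wpM2l // exprn_ge0.
rewrite /hermite_bounded big_split_ord big_ord1 bordermx_diag0.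
under eq_bigr do rewrite bordermx_diagS.
rewrite -(ler_pM2l (exprn_gt0 n a_gt0)) [leRHS]mulrCA det_bordermx.
by rewrite (mulrCA _ a) [leLHS]mulrCA [leRHS]mulrCA ler_pM2l // [leLHS]mulrCA.
Qed.

Lemma centered_remainder (a x : int) : 0 < a ->
  exists t : int, 4 * (a * t + x) ^+ 2 <= a ^+ 2.
Proof.
move=> a_gt0; have a_neq0 : a != 0 by rewrite gt_eqF.
have := divz_eq x a; have := modz_ge0 x a_neq0; have := ltz_pmod x a_gt0.
move: (x %/ a)%Z (x %% a)%Z => q y lt_ya y_ge0 ->.
have [le_y|lt_y] := leP (2 * y) a; [exists (- q) | exists (- q - 1)]; nia.
Qed.

Definition minimal_diag (n : nat) (A : 'M[int]_n) (i : 'I_n) : Prop :=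
  forall (U : 'M[int]_n) (j : 'I_n), U \in unitmx -> A i i <= congmx U A j j.

Lemma ex_minimal_diag (n : nat) (A : 'M[int]_n) (i : 'I_n) :
  posdefmx A -> exists2 U, U \in unitmx & minimal_diag (congmx U A) i.
Proof.
move=> pA; pose diag_value := [pred m : nat |
  `[< exists U j, U \in unitmx /\ congmx U A j j = m%:Z >]].
have diag_valueP U j : U \in unitmx ->
    exists2 m : nat, diag_value m & congmx U A j j = m%:Z.
  move=> uU; have := posdefmx_diag_gt0 j (posdefmx_congmx uU pA).
  case def_m: (congmx U A j j) => [m|//] _; exists m => //.
  by apply/asboolP; exists U, j.
have ex_value : exists m, diag_value m.
  by have [m] := diag_valueP _ i (unitmx1 _ n); exists m.
case: (ex_minnP ex_value) => m /asboolP[V [k [uV def_m]]] min_m.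
have uPV : tperm_mx i k *m V \in unitmx by rewrite unitmx_mul unitmx_perm.
exists (tperm_mx i k *m V) => // U j uU; rewrite -congmxM.
have uUPV : U *m (tperm_mx i k *m V) \in unitmx by rewrite unitmx_mul uU.
have [l /min_m le_ml ->] := diag_valueP _ j uUPV.
have -> : congmx (tperm_mx i k *m V) A i i = congmx V A k k.
  rewrite -[LHS]congmx_row -[RHS]congmx_row; congr (congmx _ A 0 0).
  by rewrite -xrowE; apply/rowP=> j'; rewrite !mxE tpermL.
by rewrite def_m lez_nat.
Qed.

(** If the first basis vector v is as short as possible, with square length a,
    and the others are lifts w of a reduced basis of the projection such that
    |<w, v>| <= a/2, then minimality of a gives
    a q(w) <= q'(w) + a^2/4 <= q'(w) + a q(w)/4
    where q' is the scaled projected form. *)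
Lemma hermite_reduction_bordermx (n : nat) (a : int) (r : 'rV[int]_n)
    (D U : 'M[int]_n) :
    posdefmx (bordermx a r D) -> minimal_diag (bordermx a r D) (lshift n 0) ->
    U \in unitmx -> hermite_bounded (congmx U (schurmx a r D)) ->
  exists2 V : 'M[int]_(1 + n),
    V \in unitmx & hermite_bounded (congmx V (bordermx a r D)).
Proof.
move=> pB minB uU bndS; have symD := tr_bordermx_sym pB.1.
have a_gt0 := posdefmx_bordermx_gt0 pB.
have [t short_t] : exists t : 'rV_n,
    forall i, 4 * (a *: t + r *m U^T) 0 i ^+ 2 <= a ^+ 2.
  have [t tP] := fin_all_exists (fun i =>
    centered_remainder ((r *m U^T) 0 i) a_gt0).
  by exists (\row_i t i) => i; have := tP i; rewrite !mxE.
have [E defE schurE] := congmx_bordermx a r t U symD.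
have uV : block_mx 1%:M 0 t^T U \in unitmx.
  by rewrite unitmxE det_lblock det1 mul1r -unitmxE.
exists (block_mx 1%:M 0 t^T U) => //; rewrite defE.
have le_aE i : a <= E i i.
  rewrite -(bordermx_diagS a (a *: t + r *m U^T) E) -defE.
  by rewrite -[leLHS](bordermx_diag0 a r D 0) minB.
apply: hermite_bounded_bordermx; rewrite ?schurE // => i.
  exact: le_trans (ltW a_gt0) (le_aE i).
by rewrite -schurE schurmx_diag_ge // ltW.
Qed.

Lemma hermite_reduction (n : nat) (A : 'M[int]_n) : posdefmx A ->
  exists2 U : 'M[int]_n, U \in unitmx & hermite_bounded (congmx U A).
Proof.
elim: n A => [|n IHn] A pA.
  by exists 1%:M; rewrite ?unitmx1 // /hermite_bounded big_ord0 det_mx00.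
have [U uU] := @ex_minimal_diag (1 + n) A (lshift n 0) pA.
have pUA := posdefmx_congmx uU pA.
have [a [r [D defUA]]] := symmx_bordermx pUA.1.
rewrite defUA in pUA * => minUA.
have [V uV bndV] := IHn _ (posdefmx_schurmx pUA).
have [W uW bndW] := hermite_reduction_bordermx pUA minUA uV bndV.
by exists (W *m U); rewrite ?unitmx_mul ?uW // congmxM defUA.
Qed.

(** * Bases of abelian groups *)

Definition lincomb (L : zmodType) (k : nat) (b : 'I_k -> L)
    (x : 'rV[int]_k) : L :=
  \sum_(i < k) b i *~ x 0 i.

Lemma lincomb_zmod_morphism (L : zmodType) (k : nat) (b : 'I_k -> L) :
  zmod_morphism (lincomb b).
Proof.
move=> x y; rewrite /lincomb -sumrB; apply: eq_bigr => i _.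
by rewrite !mxE mulrzBr.
Qed.

HB.instance Definition _ (L : zmodType) (k : nat) (b : 'I_k -> L) :=
  GRing.isZmodMorphism.Build 'rV[int]_k L (lincomb b) (lincomb_zmod_morphism b).

Lemma raddf_lincomb (L M : zmodType) (f : {additive L -> M}) (k : nat)
    (b : 'I_k -> L) (x : 'rV[int]_k) :
  f (lincomb b x) = lincomb (f \o b) x.
Proof. by rewrite raddf_sum; apply: eq_bigr => i _; rewrite raddfMz. Qed.

Lemma lincomb_row1 (L : zmodType) (k : nat) (b : 'I_k -> L) (i : 'I_k) :
  lincomb b (row i 1%:M) = b i.
Proof.
rewrite /lincomb (bigD1 i) //= big1 ?addr0 => [|j ne_ji]; rewrite !mxE.
  by rewrite eqxx.
by rewrite eq_sym (negPf ne_ji).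
Qed.

Definition basis_change (L : zmodType) (k l : nat) (U : 'M[int]_(l, k))
    (b : 'I_k -> L) (i : 'I_l) : L :=
  lincomb b (row i U).

Lemma lincomb_basis_change (L : zmodType) (k l : nat) (U : 'M[int]_(l, k))
    (b : 'I_k -> L) (x : 'rV[int]_l) :
  lincomb (basis_change U b) x = lincomb b (x *m U).
Proof.
rewrite /lincomb; under eq_bigr do rewrite mulrz_suml.
rewrite exchange_big /=; apply: eq_bigr => j _.
rewrite mxE mulrz_sumr; apply: eq_bigr => i _.
by rewrite mxE -mulrzA mulrC.
Qed.

Lemma zbasisP (L : zmodType) (k : nat) (b : 'I_k -> L) :
  zbasis b <-> bijective (lincomb b).
Proof.
split=> [[spanb freeb]|bijb].
  have /choice[g Kg] x : exists c, lincomb b c = x.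
    have [c ->] := spanb x; exists (\row_i c i).
    by apply: eq_bigr => i _; rewrite mxE.
  exists g => // c; apply/rowP=> i; apply/eqP; rewrite -subr_eq0; apply/eqP.
  have := freeb (fun i => (g (lincomb b c) - c) 0 i) _ i; rewrite !mxE; apply.
  by rewrite -[LHS]/(lincomb b _) raddfB /= Kg subrr.
have [g _ Kg] := bijb; split=> [x|c c0 i].
  by exists (fun i => g x 0 i); rewrite -[LHS]Kg.
suff /rowP/(_ i) : \row_i c i = 0 by rewrite !mxE.
apply: (bij_inj bijb); rewrite raddf0 -[RHS]c0.
by apply: eq_bigr => j _; rewrite mxE.
Qed.

Lemma zbasis_basis_change (L : zmodType) (k : nat) (U : 'M[int]_k)
    (b : 'I_k -> L) :
  U \in unitmx -> zbasis b -> zbasis (basis_change U b).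
Proof.
move=> uU /zbasisP bijb; apply/zbasisP.
apply: eq_bij (bij_comp bijb _) _ _ => [|x]; last first.
  by rewrite lincomb_basis_change.
by exists (mulmx^~ (invmx U)) => x; rewrite (mulmxK uU, mulmxKV uU).
Qed.

Lemma zbasis_size_le (L : zmodType) (k l : nat) (b : 'I_k -> L)
    (b' : 'I_l -> L) :
  zbasis b -> zbasis b' -> (k <= l)%N.
Proof.
move=> /zbasisP bijb /zbasisP[g' _ Kg']; have [g _ Kg] := bijb.
pose U := \matrix_i g' (b i); pose V := \matrix_i g (b' i).
apply: (@mulmx1_min _ _ _ U V); apply/row_matrixP => i.
apply: (bij_inj bijb); rewrite lincomb_row1 row_mul -lincomb_basis_change rowK.
rewrite -[RHS]Kg'; apply: eq_bigr => j _.
by rewrite /basis_change rowK Kg.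
Qed.

Lemma zbasis_size (L : zmodType) (k l : nat) (b : 'I_k -> L) (b' : 'I_l -> L) :
  zbasis b -> zbasis b' -> k = l.
Proof.
move=> zb zb'; apply/eqP; rewrite eqn_leq.
by rewrite (zbasis_size_le zb zb') (zbasis_size_le zb' zb).
Qed.

Lemma zbasis_bij_additive (L M : zmodType) (k : nat) (b : 'I_k -> L)
    (b' : 'I_k -> M) :
    zbasis b -> zbasis b' ->
  exists2 f : {additive L -> M}, bijective f & forall i, f (b i) = b' i.
Proof.
move=> /zbasisP[g gK Kg] /zbasisP[g' g'K Kg'].
pose f x := lincomb b' (g x).
have fB : zmod_morphism f.
  by move=> x y; rewrite /f -raddfB -[in LHS](Kg x) -[in LHS](Kg y) -raddfB gK.
pose F : {additive L -> M} := HB.pack f (GRing.isZmodMorphism.Build L M f fB).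
exists F.
  by exists (fun y => lincomb b (g' y)) => x /=; rewrite /f ?gK ?g'K ?Kg ?Kg'.
by move=> i /=; rewrite -lincomb_row1 /f gK lincomb_row1.
Qed.

(** * Bases of lattices *)

Lemma form_zmod_morphism (L : lattice) (x : L) : zmod_morphism (form x).
Proof. by move=> y z; rewrite -[in RHS](subrK z y) [in RHS]formDr addrK. Qed.

HB.instance Definition _ (L : lattice) (x : L) :=
  GRing.isZmodMorphism.Build L int (form x) (form_zmod_morphism x).

Section LatticeBases.

Variable L : lattice.
Implicit Types x y : L.

Lemma form_ge0 x : 0 <= form x x.
Proof. by have [->|/form_posdef/ltW//] := eqVneq x 0; rewrite raddf0. Qed.

(** The arithmetic mean replaces the geometric mean of Cauchy-Schwarz. *)
Lemma norm_form_le x y : 2 * `|form x y| <= form x x + form y y.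
Proof.
have formNr z t : form z (- t) = - form z t :> int by rewrite raddfN.
have formNl z t : form (- z) t = - form z t :> int.
  by rewrite formC formNr formC.
have := form_ge0 (x + y); have := form_ge0 (x - y).
by rewrite !formDl !formDr !formNr !formNl (formC y x); lia.
Qed.

Variable k : nat.
Implicit Types b : 'I_k -> L.

Lemma form_lincomb b (c d : 'rV[int]_k) :
  form (lincomb b c) (lincomb b d) = (c *m gram b *m d^T) 0 0.
Proof.
rewrite raddf_lincomb mxE; apply: eq_bigr => j _ /=.
rewrite formC raddf_lincomb mulrzz !mxE; congr (_ * _).
by apply: eq_bigr => i _; rewrite mulrzz mxE /= formC mulrC.
Qed.

Lemma gram_basis_change b (l : nat) (U : 'M[int]_(l, k)) :
  gram (basis_change U b) = congmx U (gram b).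
Proof. by apply/matrixP=> i j; rewrite mxE form_lincomb congmxE. Qed.

Lemma posdefmx_gram b : zbasis b -> posdefmx (gram b).
Proof.
move=> /zbasisP bijb; split=> [|x x_neq0].
  by apply/matrixP=> i j; rewrite !mxE formC.
rewrite -form_lincomb; apply: form_posdef; apply: contraNneq x_neq0.
by rewrite -(raddf0 (lincomb b)) => /(bij_inj bijb) ->.
Qed.

Lemma eq_form_zbasis b x y :
  zbasis b -> (forall j, form x (b j) = form y (b j)) -> x = y.
Proof.
move=> /zbasisP[g _ Kg] eq_xy.
have norm0 : form (x - y) (x - y) = 0.
  rewrite -[X in form _ X]Kg raddf_lincomb; apply: big1 => i _ /=.
  by rewrite formC raddfB /= !(formC (b i)) eq_xy subrr mul0rz.
apply/eqP; rewrite -subr_eq0; apply/negPn/negP => /form_posdef.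
by rewrite norm0 ltxx.
Qed.

End LatticeBases.

Lemma reduced_zbasis (L : lattice) (k : nat) (d : int) :
    has_rank L k -> has_gram_det L d ->
  exists2 b : 'I_k -> L,
    zbasis b & forall i, form (b i) (b i) <= 4 ^+ 'C(k, 2) * d.
Proof.
move=> [b0 zb0] [l [b [zb <-]]]; have eq_lk := zbasis_size zb zb0.
case: _ / eq_lk => {b0 zb0}.
have pb := posdefmx_gram zb; have [U uU bndU] := hermite_reduction pb.
have pU := posdefmx_congmx uU pb.
exists (basis_change U b) => [|i]; first exact: zbasis_basis_change.
have -> : form (basis_change U b i) (basis_change U b i)
    = congmx U (gram b) i i.
  by rewrite -gram_basis_change mxE.
rewrite -(det_congmx_unit (gram b) uU); apply: le_trans bndU.
apply: le_trans (posdefmx_diag_le_prod i pU) _; apply: ler_peMl.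
  by apply: prodr_ge0 => j _; apply/ltW/posdefmx_diag_gt0.
exact: exprn_ege1.
Qed.

(** * Classes of G-lattices *)

Lemma act_zmod_morphism (G : finGroupType) (u : G) (L : glattice u) (s : G) :
  zmod_morphism (@act G u L s).
Proof. by move=> x y; rewrite -[in RHS](subrK y x) [in RHS]actD addrK. Qed.

HB.instance Definition _ (G : finGroupType) (u : G) (L : glattice u) (s : G) :=
  GRing.isZmodMorphism.Build L L (@act G u L s) (@act_zmod_morphism G u L s).

Section GLatticeClasses.

Variables (G : finGroupType) (u : G).
Implicit Types L M N : glattice u.

Definition act_gram L (k : nat) (b : 'I_k -> L) :
    {ffun G * 'I_k * 'I_k -> int} :=
  [ffun p => form (act p.1.1 (b p.1.2)) (b p.2)].

Lemma norm_act_gram_le L (k : nat) (b : 'I_k -> L) (B : int) :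
    (forall i, form (b i) (b i) <= B) ->
  forall p, `|act_gram b p| <= B.
Proof.
move=> le_bB [[s i] j]; rewrite ffunE /=.
have := norm_form_le (act s (b i)) (b j); rewrite act_form.
by have := le_bB i; have := le_bB j; lia.
Qed.

Lemma giso_act_gram L M (k : nat) (b : 'I_k -> L) (b' : 'I_k -> M) :
  zbasis b -> zbasis b' -> act_gram b = act_gram b' -> giso L M.
Proof.
move=> zb zb' eq_bb'; have [f bij_f fb] := zbasis_bij_additive zb zb'.
have /zbasisP[g _ Kg] := zb.
have eq_act s i j : form (act s (b i)) (b j) = form (act s (b' i)) (b' j).
  by have /ffunP/(_ (s, i, j)) := eq_bb'; rewrite !ffunE.
have f_lincomb c : f (lincomb b c) = lincomb b' c.
  by rewrite raddf_lincomb; apply: eq_bigr => i _; rewrite /= fb.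
have f_form x y : form (f x) (f y) = form x y.
  rewrite -(Kg x) -(Kg y) !f_lincomb !form_lincomb.
  congr ((_ *m _ *m _) _ _); apply/matrixP=> i j; rewrite !mxE.
  by have := eq_act 1%g i j; rewrite !act1.
exists f; split=> // s x; apply: (eq_form_zbasis zb') => j.
rewrite -[in LHS]fb f_form -(Kg x) f_lincomb !raddf_lincomb.
rewrite !(formC (lincomb _ _)) !raddf_lincomb.
by apply: eq_bigr => i _; rewrite /= formC eq_act formC.
Qed.

Lemma giso_sym L M : giso L M -> giso M L.
Proof.
move=> [f [[g fK gK] f_form f_act]].
have gB : zmod_morphism g.
  by move=> x y; apply: (can_inj fK); rewrite raddfB !gK.
pose F : {additive M -> L} := HB.pack g (GRing.isZmodMorphism.Build M L g gB).
exists F; split=> [|x y|s x] /=; first by exists f.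
  by rewrite -f_form !gK.
by apply: (can_inj fK); rewrite f_act !gK.
Qed.

Lemma giso_trans L M N : giso L M -> giso M N -> giso L N.
Proof.
move=> [f [bij_f f_form f_act]] [g [bij_g g_form g_act]].
exists (g \o f : {additive L -> N}); split=> [|x y|s x] /=.
- exact: bij_comp.
- by rewrite g_form f_form.
- by rewrite f_act g_act.
Qed.

Lemma eq_giso_class L M : giso L M -> giso L = giso M.
Proof.
move=> isoLM; apply: funext => N; apply: propext.
by split; apply: giso_trans; first apply: giso_sym.
Qed.

Lemma finite_giso_classes (k : nat) (d : int) :
  finite_pred (fun C : glattice u -> Prop =>
    exists2 L : glattice u, has_rank L k /\ has_gram_det L d & C = giso L).
Proof.
pose B := absz (4 ^+ 'C(k, 2) * d).
pose code (C : glattice u -> Prop) c := exists L (b : 'I_k -> L),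
  [/\ C = giso L, zbasis b & act_gram b = c].
apply: (@finite_pred_bounded_code _ B _ _ code) => [_ [L [rkL detL] ->]|].
  have [b zb le_b] := reduced_zbasis rkL detL.
  exists (act_gram b); first by exists L, b.
  by apply: norm_act_gram_le => i; apply: le_trans (le_b i) (lez_abs _).
move=> _ _ c _ _ [L [b [-> zb <-]]] [M [b' [-> zb' eq_bb']]].
exact/eq_giso_class/(giso_act_gram zb zb').
Qed.

End GLatticeClasses.

Theorem theorem14p5 (G : finGroupType) (u : G)
    (abG : abelian [set: G]%g) (ordu : #[u]%g = 2) :
  finite_pred (@WPic G u).
Proof.
apply: finite_pred_sub (finite_giso_classes u (#|G| %/ 2) 1).
by move=> _ [L [rkL detL _] ->]; exists L.
Qed.
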